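(* Let $\gamma>0$. Consider the augmented system $\eta_{k+1}=\tilde f_k(\eta_k,w_k,v_k)$, $\tilde z_k=\tilde m_k(\eta_k,v_k)$, $k\in\mathcal N$, described in the context. Suppose there exists a positive definite Lyapunov function sequence $\{V_k(\eta)\}_{k\in\mathcal N}$, $V_k:\mathcal R^{n_\eta}\to[0,\infty)$, such that $$E[V_{k+1}(\tilde f_k(\eta,w_k,v))]-V_k(\eta)+\|\tilde m_k(\eta,v)\|^2-\gamma^2\|v\|^2\le 0\qquad\text{for all }\eta\in\mathcal R^{n_\eta},\ v\in\mathcal R^{n_v},\ k\in\mathcal N.$$ Then the augmented system is externally stable (with level $\gamma$): for every nonzero $v=\{v_k\}_{k\in\mathcal N}\in l^2_\infty(\Omega,\mathcal F,\{\mathcal F_k\}_{k\in\mathcal N},\mathcal R^{n_v})$ and zero initial state $\eta_0=0$, $$E\Big[\sum_{k=0}^\infty\|\tilde z_k\|^2\Big]\le\gamma^2E\Big[\sum_{k=0}^\infty\|v_k\|^2\Big].$$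
   Context: $\mathcal N=\{0,1,2,\dots\}$. $\{w_k\}_{k\in\mathcal N}$ is a sequence of independent $\mathcal R^{n_w}$-valued random variables on a complete probability space $(\Omega,\mathcal F,\mathcal P)$, $\mathcal F_0=\{\emptyset,\Omega\}$, $\mathcal F_k=\sigma(w_0,\dots,w_{k-1})$. $l^2_\infty(\Omega,\mathcal F,\{\mathcal F_k\},\mathcal R^{n_v})$ is the space of $\mathcal F_k$-adapted sequences $\{v_k\}$ (i.e. $v_k$ is $\mathcal F_k$-measurable) with $E\sum_{k\ge0}\|v_k\|^2<\infty$. System: $x_{k+1}=f_k(x_k,w_k,v_k)$, $y_k=g_k(x_k,v_k)$, $z_k=m_k(x_k,v_k)$, with $x_k\in\mathcal R^n$, $y_k\in\mathcal R^{n_y}$, $z_k\in\mathcal R^{n_z}$, disturbance $v_k\in\mathcal R^{n_v}$, where $f_k,g_k,m_k$ are continuous with $f_k(0,0,0)=0$, $g_k(0,0)=0$, $m_k(0,0)=0$ for all $k$. Filter: $\hat x_{k+1}=\hat f_k(\hat x_k)+\hat g_k(y_k)$, $\hat z_k=\hat m_k(\hat x_k)$, $\hat x_0=0$, with $\hat x_k\in\mathcal R^{n_{\hat x}}$ and (Borel measurable) maps satisfying $\hat f_k(0)=\hat g_k(0)=0$, $\hat m_k(0)=0$. Augmented system: $\eta_k=\begin{bmatrix}x_k\\ \hat x_k\end{bmatrix}\in\mathcal R^{n_\eta}$, $\tilde z_k=z_k-\hat z_k$, and for $\eta=\begin{bmatrix}x\\ \hat x\end{bmatrix}$, $\tilde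 f_k(\eta,w,v)=\begin{bmatrix}f_k(x,w,v)\\ \hat f_k(\hat x)+\hat g_k(g_k(x,v))\end{bmatrix}$, $\tilde m_k(\eta,v)=m_k(x,v)-\hat m_k(\hat x)$. Positive definite Lyapunov function sequence: each $V_k$ is continuous, $V_k(0)=0$ for all $k$, and there is a continuous strictly increasing $\mu:[0,\infty)\to[0,\infty)$ with $\mu(0)=0$, $\mu(t)>0$ for $t>0$, such that $V_k(\eta)\ge\mu(\|\eta\|)$ for all $k\in\mathcal N$ and all $\eta\in\mathcal R^{n_\eta}$. *)

(* Defs.v *)
From HB Require Import structures.
From mathcomp Require Import all_boot all_order all_algebra finmap.
From mathcomp Require Import all_classical all_reals all_analysis.

Set Implicit Arguments.
Unset Strict Implicit.
Unset Printing Implicit Defensive.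

Import Order.TTheory GRing.Theory Num.Theory.
Import numFieldNormedType.Exports.

Local Open Scope classical_set_scope.
Local Open Scope ring_scope.

(* The library norm on matrices is the sup norm, whence a separate Euclidean
   one; both induce the library topology of 'cV[R]_n. *)
Definition enorm (R : realType) (n : nat) (x : 'cV[R]_n) : R :=
  Num.sqrt (\sum_(i < n) x i ord0 ^+ 2).

(* R^n with its Borel sigma-algebra. *)
Notation borel_cV R n := (g_sigma_algebraType (@open 'cV[R]_n)).

Definition random_vector (R : realType) (d : measure_display)
    (T : measurableType d) (n : nat) (X : T -> 'cV[R]_n) : Prop :=
  measurable_fun [set: T] (X : T -> borel_cV R n).

Definition borel_map (R : realType) (n m : nat)
    (h : 'cV[R]_n -> 'cV[R]_m) : Prop :=
  measurable_fun [set: borel_cV R n] (h : borel_cV R n -> borel_cV R m).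

(* Mutual independence: product rule over every finite subfamily. *)
Definition independent_vectors (R : realType) (d : measure_display)
    (T : measurableType d) (P : probability T R) (n : nat)
    (w : nat -> T -> 'cV[R]_n) : Prop :=
  forall (J : {fset nat}) (B : nat -> set (borel_cV R n)),
    (forall j, j \in J -> measurable (B j)) ->
    P (\bigcap_(j in [set` J]) (w j @^-1` B j)) =
    (\prod_(j <- J) P (w j @^-1` B j))%E.

(* F_k = sigma(w_0, ..., w_(k-1)); for k = 0 the generating family is empty,
   so that F_0 = {set0, setT}. *)
Definition natural_filtration (R : realType) (T : Type) (n : nat)
    (w : nat -> T -> 'cV[R]_n) (k : nat) : set (set T) :=
  <<s \bigcup_(j in `I_k)
        preimage_set_system setT (w j) (@measurable _ (borel_cV R n)) >>.

Definition adapted (R : realType) (T : Type) (n : nat)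
    (F : nat -> set (set T)) (v : nat -> T -> 'cV[R]_n) : Prop :=
  forall k (B : set (borel_cV R n)), measurable B -> F k (v k @^-1` B).

(* E [ sum_(k >= 0) |u_k|^2 ], possibly +oo. *)
Definition energy (R : realType) (d : measure_display)
    (T : measurableType d) (P : probability T R) (n : nat)
    (u : nat -> T -> 'cV[R]_n) : \bar R :=
  (\int[P]_t \sum_(0 <= k <oo) (enorm (u k t) ^+ 2)%:E)%E.

Definition l2_infty (R : realType) (d : measure_display)
    (T : measurableType d) (P : probability T R) (n : nat)
    (F : nat -> set (set T)) : set (nat -> T -> 'cV[R]_n) :=
  [set v | adapted F v /\ (energy P v < +oo)%E].

Section augmented_system.
Variables (R : realType) (n ny nz nw nv nh : nat).

Definition aug_f
    (f : nat -> 'cV[R]_n -> 'cV[R]_nw -> 'cV[R]_nv -> 'cV[R]_n)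
    (g : nat -> 'cV[R]_n -> 'cV[R]_nv -> 'cV[R]_ny)
    (fh : nat -> 'cV[R]_nh -> 'cV[R]_nh) (gh : nat -> 'cV[R]_ny -> 'cV[R]_nh)
    (k : nat) (eta : 'cV[R]_(n + nh)) (w : 'cV[R]_nw) (v : 'cV[R]_nv) :
    'cV[R]_(n + nh) :=
  col_mx (f k (usubmx eta) w v)
         (fh k (dsubmx eta) + gh k (g k (usubmx eta) v)).

Definition aug_m
    (m : nat -> 'cV[R]_n -> 'cV[R]_nv -> 'cV[R]_nz)
    (mh : nat -> 'cV[R]_nh -> 'cV[R]_nz)
    (k : nat) (eta : 'cV[R]_(n + nh)) (v : 'cV[R]_nv) : 'cV[R]_nz :=
  m k (usubmx eta) v - mh k (dsubmx eta).

End augmented_system.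

Section stability.
Variables (R : realType) (p nz nw nv : nat).
Variable ft : nat -> 'cV[R]_p -> 'cV[R]_nw -> 'cV[R]_nv -> 'cV[R]_p.
Variable mt : nat -> 'cV[R]_p -> 'cV[R]_nv -> 'cV[R]_nz.

Fixpoint state (T : Type) (w : nat -> T -> 'cV[R]_nw)
    (v : nat -> T -> 'cV[R]_nv) (eta0 : 'cV[R]_p) (k : nat) (t : T) :
    'cV[R]_p :=
  if k is j.+1 then ft j (state w v eta0 j t) (w j t) (v j t) else eta0.

Definition output (T : Type) (w : nat -> T -> 'cV[R]_nw)
    (v : nat -> T -> 'cV[R]_nv) (eta0 : 'cV[R]_p) (k : nat) (t : T) :
    'cV[R]_nz :=
  mt k (state w v eta0 k t) (v k t).

(* [v] is nonzero as a sequence of functions; in particular every [v] that is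
   nonzero modulo almost sure equality is covered. *)
Definition externally_stable (d : measure_display) (T : measurableType d)
    (P : probability T R) (w : nat -> T -> 'cV[R]_nw) (gamma : R) : Prop :=
  forall v : nat -> T -> 'cV[R]_nv,
    l2_infty P (natural_filtration w) v ->
    (exists k t, v k t != 0) ->
    (energy P (output w v 0) <= (gamma ^+ 2)%:E * energy P v)%E.

Definition dissipative (d : measure_display) (T : measurableType d)
    (P : probability T R) (w : nat -> T -> 'cV[R]_nw) (gamma : R)
    (V : nat -> 'cV[R]_p -> R) : Prop :=
  forall (k : nat) (eta : 'cV[R]_p) (v : 'cV[R]_nv),
    ('E_P[fun t => V k.+1 (ft k eta (w k t) v)] - (V k eta)%:E
      + (enorm (mt k eta v) ^+ 2)%:E - (gamma ^+ 2 * enorm v ^+ 2)%:E <= 0)%E.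

End stability.

(* [mu] is only constrained on [0, +oo[. *)
Definition lyapunov_sequence (R : realType) (p : nat)
    (V : nat -> 'cV[R]_p -> R) : Prop :=
  [/\ forall k eta, 0 <= V k eta,
      forall k, continuous (V k),
      forall k, V k 0 = 0
    & exists mu : R -> R,
      [/\ {within `[0, +oo[, continuous mu},
          {in `[0, +oo[ &, {homo mu : s t / s < t}},
          mu 0 = 0,
          forall t, 0 < t -> 0 < mu t
        & forall k eta, mu (enorm eta) <= V k eta]].

(* Main.v *)
(* By induction, eta_k and v_k are F_k-measurable, hence jointly independent of
   w_k. Fubini for the product of the laws of (eta_k, v_k) and w_k then allows
   freezing (eta_k, v_k) when averaging over w_k, so that the dissipation
   inequality integrates to
     E V_(k+1)(eta_(k+1)) + E |z_k|^2 <= E V_k(eta_k) + gamma^2 E |v_k|^2.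
   Starting from V_0(0) = 0 this telescopes, in [0, +oo] and without any
   subtraction, to a bound on all the partial sums of E |z_k|^2. *)
Require Import Defs.
From HB Require Import structures.
From mathcomp Require Import all_boot all_order all_algebra finmap.
From mathcomp Require Import all_classical all_reals all_analysis.
From mathcomp Require Import measurable_realfun.

Set Implicit Arguments.
Unset Strict Implicit.
Unset Printing Implicit Defensive.

Import Order.TTheory GRing.Theory Num.Theory.
Import numFieldNormedType.Exports.

Local Open Scope classical_set_scope.
Local Open Scope ring_scope.

(** * Borel measurability of vector-valued maps *)

Lemma random_vectorP (R : realType) (d : measure_display)
    (T : measurableType d) (n : nat) (X : T -> 'cV[R]_n) :
  random_vector X <->
  forall B : set (borel_cV R n), measurable B -> measurable (X @^-1` B).
Proof.
split=> [mX B mB|mX _ B mB]; last by rewrite setTI; exact: mX.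
by rewrite -[X in measurable X]setTI; exact: mX.
Qed.

Lemma continuous_random_variable (R : realType) (d : measure_display)
    (T : measurableType d) (n : nat) (h : 'cV[R]_n -> R) (X : T -> 'cV[R]_n) :
  continuous h -> random_vector X -> measurable_fun setT (fun t => h (X t)).
Proof.
move=> /continuousP hc /random_vectorP mX.
apply: (measurability _ (RGenOpens.measurableE R)).
move=> _ [_ [a [b ->]] <-]; rewrite setTI.
apply: (mX (h @^-1` `]a, b[)).
by apply: sub_sigma_algebra; apply: hc; exact: interval_open.
Qed.

(** Rational centres with radii [k.+1%:R^-1] index a countable base of the topology; this is what
    reduces arbitrary open sets to countable unions. *)
Lemma ratr_mx_ball (R : realType) (n : nat) (U : set 'cV[R]_n) (x : 'cV[R]_n) :
  open U -> U x ->
  exists q : 'cV[rat]_n * nat,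
    ball (map_mx ratr q.1 : 'cV[R]_n) q.2.+1%:R^-1 `<=` U /\
    ball (map_mx ratr q.1 : 'cV[R]_n) q.2.+1%:R^-1 x.
Proof.
move=> oU Ux.
have /nbhs_ballP[e /= e0 eU] : nbhs x U by exact: open_nbhs_nbhs.
(* The radius is below [e / 2] because a point of the ball reaches [x] in two hops, through the
   rational centre. *)
have [k ke] : exists k : nat, k.+1%:R^-1 < e / 2.
  exists (Num.truncn (e / 2)^-1).
  rewrite invf_plt ?posrE ?divr_gt0 //.
  exact: truncnS_gt.
have k0 : 0 < k.+1%:R^-1 :> R by rewrite invr_gt0.
have qP i : exists q : rat, ball (ratr q : R) k.+1%:R^-1 (x i ord0).
  have [] := @dense_rat R (ball (x i ord0) k.+1%:R^-1).
  - by exists (x i ord0); exact: ballxx.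
  - exact: ball_open.
  - by move=> y [/ball_sym b [q _ qE]]; exists q; rewrite qE.
pose q : 'cV[rat]_n := \col_i projT1 (cid (qP i)).
have qx : ball (map_mx ratr q : 'cV[R]_n) k.+1%:R^-1 x.
  by split=> // i j; rewrite !mxE (ord1 j); case: cid.
exists (q, k); split=> // y qy; apply: eU.
have ball_half (a b : 'cV[R]_n) : ball a k.+1%:R^-1 b -> ball a (e / 2) b.
  by apply: le_ball; exact: ltW.
rewrite (splitr e); apply: (ball_triangle (ball_half _ _ _) (ball_half _ _ qy)).
exact: ball_sym.
Qed.

(** Coordinates are continuous, which gives one direction. Conversely, an open set is a countable
    union of rational balls, and a ball of the sup norm is a box, so its preimage is a finite
    intersection of preimages under coordinates. *)
Lemma random_vector_coord (R : realType) (d : measure_display)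
    (T : measurableType d) (n : nat) (X : T -> 'cV[R]_n) :
  random_vector X <-> forall i, measurable_fun setT (fun t => X t i ord0).
Proof.
split=> [mX i|mX].
  exact: (continuous_random_variable (@coord_continuous R n 1 i ord0) mX).
apply: (@measurability _ _ T (borel_cV R n) _ _ (@open 'cV[R]_n)) => //.
move=> _ [U oU <-]; rewrite setTI.
pose b (q : 'cV[rat]_n * nat) : set 'cV[R]_n :=
  ball (map_mx ratr q.1 : 'cV[R]_n) q.2.+1%:R^-1.
(* Balls that are not contained in [U] contribute [set0], so that the union ranges over the whole
   countable index type. *)
have -> : X @^-1` U =
    \bigcup_q (if `[< b q `<=` U >] then X @^-1` b q else set0).
  apply/seteqP; split=> [t Ut|t [q _]].
    have [q [qU qt]] := ratr_mx_ball oU Ut.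
    by exists q => //; rewrite asboolT.
  by case: asboolP => [qU /qU|].
apply: countable_bigcupT_measurable => [|q]; first exact: countableP.
case: asboolP => // _.
have -> : X @^-1` b q = \bigcap_(i in [set: 'I_n])
   ((fun t => X t i ord0) @^-1` ball (ratr (q.1 i ord0) : R) q.2.+1%:R^-1).
  apply/seteqP; split=> [t [_ Xq] i _ /=|t Xq].
    by have := Xq i ord0; rewrite mxE.
  split=> [|i j]; first by rewrite invr_gt0.
  by rewrite mxE (ord1 j); exact: Xq.
apply: fin_bigcap_measurable => [|i _]; first exact: finite_finset.
have := mX i measurableT (ball (ratr (q.1 i ord0) : R) q.2.+1%:R^-1).
by rewrite setTI; apply; apply: open_measurable; exact: ball_open.
Qed.

Lemma enorm_sqr (R : realType) (n : nat) (x : 'cV[R]_n) :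
  enorm x ^+ 2 = \sum_(i < n) x i ord0 ^+ 2.
Proof. by rewrite sqr_sqrtr // sumr_ge0 // => i _; exact: sqr_ge0. Qed.

Section random_vector_operations.
Context (R : realType) (d : measure_display) (T : measurableType d).

Lemma random_vector_col_mx (n m : nat) (X : T -> 'cV[R]_n) (Y : T -> 'cV[R]_m) :
  random_vector X -> random_vector Y ->
  random_vector (fun t => col_mx (X t) (Y t)).
Proof.
move=> /random_vector_coord mX /random_vector_coord mY.
apply/random_vector_coord => i; case: (splitP i) => j ij.
  have -> : i = lshift m j by exact: val_inj.
  by under eq_fun do rewrite col_mxEu; exact: mX.
have -> : i = rshift n j by exact: val_inj.
by under eq_fun do rewrite col_mxEd; exact: mY.
Qed.

Lemma random_vector_usubmx (n m : nat) (X : T -> 'cV[R]_(n + m)) :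
  random_vector X -> random_vector (fun t => usubmx (X t)).
Proof.
move=> /random_vector_coord mX; apply/random_vector_coord => i.
by under eq_fun do rewrite mxE; exact: mX.
Qed.

Lemma random_vector_dsubmx (n m : nat) (X : T -> 'cV[R]_(n + m)) :
  random_vector X -> random_vector (fun t => dsubmx (X t)).
Proof.
move=> /random_vector_coord mX; apply/random_vector_coord => i.
by under eq_fun do rewrite mxE; exact: mX.
Qed.

Lemma random_vectorD (n : nat) (X Y : T -> 'cV[R]_n) :
  random_vector X -> random_vector Y -> random_vector (fun t => X t + Y t).
Proof.
move=> /random_vector_coord mX /random_vector_coord mY.
apply/random_vector_coord => i.
by under eq_fun do rewrite mxE; exact: measurable_funD.
Qed.

Lemma random_vectorB (n : nat) (X Y : T -> 'cV[R]_n) :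
  random_vector X -> random_vector Y -> random_vector (fun t => X t - Y t).
Proof.
move=> /random_vector_coord mX /random_vector_coord mY.
apply/random_vector_coord => i.
by under eq_fun do rewrite !mxE; exact: measurable_funB.
Qed.

Lemma measurable_enorm_sqr (n : nat) (X : T -> 'cV[R]_n) :
  random_vector X -> measurable_fun setT (fun t => enorm (X t) ^+ 2).
Proof.
move=> /random_vector_coord mX.
under eq_fun do rewrite enorm_sqr.
apply: measurable_sum => i; exact: measurable_funX.
Qed.

Lemma borel_map_comp (n m : nat) (h : 'cV[R]_n -> 'cV[R]_m)
    (X : T -> 'cV[R]_n) :
  borel_map h -> random_vector X -> random_vector (fun t => h (X t)).
Proof. by move=> mh mX; exact: measurableT_comp mh mX. Qed.

Lemma random_vector_cst (n : nat) (c : 'cV[R]_n) :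
  random_vector (fun _ : T => c).
Proof. exact: measurable_cst. Qed.

End random_vector_operations.

(** * Continuous maps of several vector arguments *)

Lemma continuous_borel_map (R : realType) (n m : nat)
    (h : 'cV[R]_n -> 'cV[R]_m) : continuous h -> borel_map h.
Proof.
move=> /continuousP hc.
apply: (@measurability _ _ _ (borel_cV R m) _ _ (@open 'cV[R]_m)) => //.
by move=> _ [U oU <-]; rewrite setTI; apply: sub_sigma_algebra; exact: hc.
Qed.

Lemma continuous_usubmx (R : realType) (n m : nat) :
  continuous (usubmx : 'cV[R]_(n + m) -> 'cV[R]_n).
Proof.
move=> x A /nbhs_ballP[e /= e0 eA]; apply/nbhs_ballP; exists e => //= y [_ xy].
by apply: eA; split=> // i j; rewrite !mxE; exact: xy.
Qed.

Lemma continuous_dsubmx (R : realType) (n m : nat) :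
  continuous (dsubmx : 'cV[R]_(n + m) -> 'cV[R]_m).
Proof.
move=> x A /nbhs_ballP[e /= e0 eA]; apply/nbhs_ballP; exists e => //= y [_ xy].
by apply: eA; split=> // i j; rewrite !mxE; exact: xy.
Qed.

(* Stacking the arguments into a single vector avoids comparing the Borel
   sigma-algebra of a product with the product of the Borel sigma-algebras. *)
Lemma continuous_comp_random_vector2 (R : realType) (d : measure_display)
    (T : measurableType d) (n m p : nat)
    (h : 'cV[R]_n * 'cV[R]_m -> 'cV[R]_p)
    (X : T -> 'cV[R]_n) (Y : T -> 'cV[R]_m) :
  continuous h -> random_vector X -> random_vector Y ->
  random_vector (fun t => h (X t, Y t)).
Proof.
move=> hc mX mY.
pose h' (x : 'cV[R]_(n + m)) := h (usubmx x, dsubmx x).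
have h'c : continuous h'.
  move=> x; apply: (@continuous_comp _ _ _ (fun x => (usubmx x, dsubmx x)) h).
    exact: cvg_pair (@continuous_usubmx R n m x) (@continuous_dsubmx R n m x).
  exact: hc.
have := borel_map_comp (continuous_borel_map h'c) (random_vector_col_mx mX mY).
by under eq_fun do rewrite /h' col_mxKu col_mxKd.
Qed.

Lemma continuous_comp_random_vector3 (R : realType) (d : measure_display)
    (T : measurableType d) (n m l p : nat)
    (h : 'cV[R]_n * 'cV[R]_m * 'cV[R]_l -> 'cV[R]_p)
    (X : T -> 'cV[R]_n) (Y : T -> 'cV[R]_m) (Z : T -> 'cV[R]_l) :
  continuous h -> random_vector X -> random_vector Y -> random_vector Z ->
  random_vector (fun t => h (X t, Y t, Z t)).
Proof.
move=> hc mX mY mZ.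
(* Stacking the first two arguments leaves a continuous map of two vectors. *)
pose h' (a : 'cV[R]_(n + m) * 'cV[R]_l) := h (usubmx a.1, dsubmx a.1, a.2).
have h'c : continuous h'.
  move=> x; apply: (@continuous_comp _ _ _
    (fun a : _ * _ => (usubmx a.1, dsubmx a.1, a.2)) h); last exact: hc.
  have uc : usubmx a.1 @[a --> x] --> usubmx x.1.
    by apply: continuous_comp; [exact: cvg_fst|exact: continuous_usubmx].
  have dc : dsubmx a.1 @[a --> x] --> dsubmx x.1.
    by apply: continuous_comp; [exact: cvg_fst|exact: continuous_dsubmx].
  exact: cvg_pair (cvg_pair uc dc) cvg_snd.
have := continuous_comp_random_vector2 h'c (random_vector_col_mx mX mY) mZ.
by under eq_fun do rewrite /h' /= col_mxKu col_mxKd.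
Qed.

(** * The natural filtration and its independence from the current noise *)

Section natural_filtration_theory.
Context (R : realType) (d : measure_display) (T : measurableType d) (n : nat).
Variable w : nat -> T -> 'cV[R]_n.

Lemma natural_filtration_generator (j k : nat) (B : set (borel_cV R n)) :
  (j < k)%N -> measurable B -> natural_filtration w k (w j @^-1` B).
Proof.
by move=> jk mB; apply: sub_sigma_algebra; exists j => //; exists B;
  rewrite ?setTI.
Qed.

Lemma natural_filtration_nondecreasing (j k : nat) :
  (j <= k)%N -> natural_filtration w j `<=` natural_filtration w k.
Proof.
move=> jk; apply: sub_smallest2r; first exact: smallest_sigma_algebra.
by move=> A [i /= ij Ai]; exists i => //=; exact: leq_trans ij jk.
Qed.

Hypothesis w_rv : forall k, random_vector (w k).

Lemma natural_filtration_measurable (k : nat) :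
  natural_filtration w k `<=` measurable.
Proof.
apply: smallest_sub => [|A [j _ [B mB <-]]].
  exact: sigma_algebra_measurable.
exact: w_rv.
Qed.

(** The family generating [natural_filtration w k] constrains one [w j] at a time and need not be
    stable under intersection. Cylinders constrain all [w j] with [j < k] at once: they form a
    pi-system with the same generated sigma-algebra. *)
Let cylinder (k : nat) : set (set T) :=
  [set A | exists2 B : nat -> set (borel_cV R n),
     forall j, measurable (B j) & A = \bigcap_(j in `I_k) (w j @^-1` B j)].

Let cylinder_setI_closed (k : nat) : setI_closed (cylinder k).
Proof.
move=> _ _ [B mB ->] [C mC ->]; exists (fun j => B j `&` C j).
  by move=> j; exact: measurableI.
by rewrite -bigcapI; apply: eq_bigcapr => j _; rewrite preimage_setI.
Qed.

Let cylinder_measurable (k : nat) : cylinder k `<=` measurable.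
Proof.
move=> _ [B mB ->]; apply: fin_bigcap_measurable => [|j _].
  exact: finite_II.
by have /random_vectorP := w_rv j; apply.
Qed.

Let natural_filtration_sub_cylinder (k : nat) :
  natural_filtration w k `<=` <<s cylinder k >>.
Proof.
apply: smallest_sub; first exact: smallest_sigma_algebra.
move=> A [j /= jk [B mB <-]]; apply: sub_sigma_algebra.
exists (fun i => if i == j then B else setT).
  by move=> i; case: ifP.
apply/seteqP; split=> [t [_ Bt] i _ /=|t Bt].
  by case: eqP => // ->.
by split=> //; have := Bt j jk; rewrite /= eqxx.
Qed.

(** A pi-lambda argument: for fixed [B], both sides are finite measures in [A], and mutual
    independence makes them agree on cylinders. *)
Lemma natural_filtration_indep (P : probability T R) (k : nat)
    (A : set T) (B : set (borel_cV R n)) :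
  independent_vectors P w -> natural_filtration w k A -> measurable B ->
  P (A `&` w k @^-1` B) = (P A * P (w k @^-1` B))%E.
Proof.
move=> w_indep FA mB.
have mkB : measurable (w k @^-1` B) by have /random_vectorP := w_rv k; apply.
have P_cylinder l (C : nat -> set (borel_cV R n)) :
    (forall j, measurable (C j)) ->
    P (\bigcap_(j in `I_l) (w j @^-1` C j)) =
    (\prod_(j <- fset_set `I_l) P (w j @^-1` C j))%E.
  by move=> mC; rewrite -w_indep // fset_setK //; exact: finite_II.
have PkB_fin : P (w k @^-1` B) \is a fin_num by exact: fin_num_measure.
(* The probability of the event on [w k] becomes a nonnegative real, so that the right-hand side is
   the scaled measure [mscale r P]. *)
pose r : {nonneg R} := NngNum (fine_ge0 (measure_ge0 P (w k @^-1` B))).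
have rE : (r%:num)%:E = P (w k @^-1` B) by rewrite /= fineK.
rewrite -rE muleC.
apply: (@g_sigma_algebra_measure_unique _ R T (cylinder k) _ (fun=> setT)
  _ _ (mrestr P mkB) (mscale r P)) => //.
- by move=> _; exists (fun=> setT) => //; apply/seteqP; split.
- by rewrite bigcup_const.
- move=> _ [C mC ->].
  (* Adding [B] in position [k] turns the intersection into a cylinder over [I_k.+1], to which the
     product rule applies; the factor of index [k] then splits off. *)
  pose D j := if j == k then B else C j.
  have mD j : measurable (D j) by rewrite /D; case: ifP.
  have DC j : (j < k)%N -> D j = C j by rewrite /D; case: ltngtP.
  have Dk : D k = B by rewrite /D eqxx.
  have DCb : \bigcap_(j in `I_k) (w j @^-1` C j) =
             \bigcap_(j in `I_k) (w j @^-1` D j).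
    by apply: eq_bigcapr => j /= /DC ->.
  have DS : \bigcap_(j in `I_k) (w j @^-1` D j) `&` (w k @^-1` B) =
            \bigcap_(j in `I_k.+1) (w j @^-1` D j).
    by rewrite IIS bigcap_setU bigcap_set1 Dk.
  suff : P (\bigcap_(j in `I_k) (w j @^-1` C j) `&` (w k @^-1` B)) =
      (P (w k @^-1` B) * P (\bigcap_(j in `I_k) (w j @^-1` C j)))%E.
    by rewrite -rE.
  rewrite DCb DS !P_cylinder // IIS setUC fset_setU1; last exact: finite_II.
  rewrite big_fsetU1 /= ?Dk //.
  rewrite in_fset_set; last exact: finite_II.
  by apply/negP; rewrite inE /= ltnn.
- by move=> _; rewrite /mrestr; apply: le_lt_trans (probability_le1 _ _) _;
    rewrite ?setTI ?ltry.
- exact: natural_filtration_sub_cylinder.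
Qed.

End natural_filtration_theory.

(** * Freezing one of two independent variables under the integral *)

Section independence_integral.
Local Open Scope ereal_scope.
Context (R : realType) (d d1 d2 : measure_display) (T : measurableType d)
  (T1 : measurableType d1) (T2 : measurableType d2) (P : probability T R).
Variables (X : {mfun T >-> T1}) (W : {mfun T >-> T2}) (h : T1 * T2 -> \bar R).
Hypotheses (mh : measurable_fun setT h) (h0 : forall z, 0 <= h z).

Lemma measurable_partial_integral :
  measurable_fun setT (fun t => \int[P]_s h (X t, W s)).
Proof.
have mhW : measurable_fun setT (fun z : T1 * T => h (z.1, W z.2)).
  apply: measurableT_comp => //; apply: measurable_fun_pair => //.
  exact: measurableT_comp.
have := @measurable_fun_fubini_tonelli_F _ _ T1 T R P _ mhW (fun z => h0 _).
by move=> /measurableT_comp; apply.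
Qed.

(** The product rule on rectangles identifies the joint law of [X] and [W] with the product of their
    laws. Tonelli's theorem then iterates the integral, and each law is pulled back to [P]. *)
Lemma integral_indep :
  (forall (A : set T1) (B : set T2), measurable A -> measurable B ->
    P (X @^-1` A `&` W @^-1` B) = P (X @^-1` A) * P (W @^-1` B)) ->
  \int[P]_t h (X t, W t) = \int[P]_t \int[P]_s h (X t, W s).
Proof.
move=> indep.
have mXW : measurable_fun setT (fun t => (X t, W t)).
  exact: measurable_fun_pair.
pose XW : {mfun T >-> (T1 * T2)%type} :=
  HB.pack (fun t => (X t, W t)) (isMeasurableFun.Build _ _ _ _ _ mXW).
rewrite -[LHS](@ge0_integral_distribution _ _ _ _ _ P XW h mh h0).
transitivity (\int[distribution P X \x distribution P W]_z h z).
  apply: eq_measure_integral => A mA _; apply/esym.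
  by apply: product_measure_unique => // B C mB mC; exact: indep.
rewrite fubini_tonelli1 // ge0_integral_distribution //.
- apply: eq_integral => t _; rewrite /fubini_F/= ge0_integral_distribution //.
  exact: measurableT_comp.
- exact: measurable_fun_fubini_tonelli_F.
- by move=> x; exact: integral_ge0.
Qed.

End independence_integral.

(** * The dissipation inequality along trajectories *)

Section dissipative_system.
Context (R : realType) (p nz nw nv : nat).
Variable ft : nat -> 'cV[R]_p -> 'cV[R]_nw -> 'cV[R]_nv -> 'cV[R]_p.
Variable mt : nat -> 'cV[R]_p -> 'cV[R]_nv -> 'cV[R]_nz.

(** Quantifying over all measurable spaces lets this apply both to [T] equipped with the
    sigma-algebra of [natural_filtration w k.+1], for adaptedness of the state, and to a product of
    Borel spaces, for the integrand of Tonelli's theorem. *)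
Hypothesis ft_rv : forall (d : measure_display) (T : measurableType d) k
    (X : T -> 'cV[R]_p) (W : T -> 'cV[R]_nw) (Y : T -> 'cV[R]_nv),
  random_vector X -> random_vector W -> random_vector Y ->
  random_vector (fun t => ft k (X t) (W t) (Y t)).

Hypothesis mt_rv : forall (d : measure_display) (T : measurableType d) k
    (X : T -> 'cV[R]_p) (Y : T -> 'cV[R]_nv),
  random_vector X -> random_vector Y ->
  random_vector (fun t => mt k (X t) (Y t)).

Context (d : measure_display) (T : measurableType d) (P : probability T R).
Variables (w : nat -> T -> 'cV[R]_nw) (v : nat -> T -> 'cV[R]_nv).
Hypotheses (w_rv : forall k, random_vector (w k))
  (w_indep : independent_vectors P w)
  (v_adapted : adapted (natural_filtration w) v).

(** Measurability for the filtration is that of a random vector on [T] with a smaller sigma-algebra,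
    so every closure property of random vectors transfers to adapted processes. *)
Lemma random_vector_filtration (n k : nat) (X : T -> 'cV[R]_n) :
  @random_vector R _ (g_sigma_algebraType (\bigcup_(j in `I_k)
    preimage_set_system setT (w j) (@measurable _ (borel_cV R nw)))) n X <->
  forall B : set (borel_cV R n), measurable B ->
    natural_filtration w k (X @^-1` B).
Proof. by rewrite random_vectorP. Qed.

Lemma state_adapted (eta0 : 'cV[R]_p) :
  adapted (natural_filtration w) (state ft w v eta0).
Proof.
elim=> [|k IH]; apply/random_vector_filtration => /=.
  exact: random_vector_cst.
have lift n (X : T -> 'cV[R]_n) :
    (forall B : set (borel_cV R n), measurable B ->
      natural_filtration w k (X @^-1` B)) ->
    forall B : set (borel_cV R n), measurable B ->
      natural_filtration w k.+1 (X @^-1` B).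
  by move=> mX B mB; apply: natural_filtration_nondecreasing (leqnSn k) _ _;
    exact: mX.
apply: ft_rv; apply/random_vector_filtration; first exact: lift IH.
  by move=> B; exact: natural_filtration_generator.
exact: lift (v_adapted (k := k)).
Qed.

Lemma adapted_random_vector (n k : nat) (X : nat -> T -> 'cV[R]_n) :
  adapted (natural_filtration w) X -> random_vector (X k).
Proof.
move=> Xa; apply/random_vectorP => B mB.
by apply: (natural_filtration_measurable w_rv (k := k)); exact: Xa.
Qed.

Variable V : nat -> 'cV[R]_p -> R.
Hypotheses (V_ge0 : forall k x, 0 <= V k x)
  (V_continuous : forall k, continuous (V k)) (V0 : forall k, V k 0 = 0).
Variable gamma : R.
Hypothesis V_dissipative : dissipative ft mt P w gamma V.

Local Open Scope ereal_scope.

Let eta := state ft w v 0.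
Let z := output ft mt w v 0.

Let eta_rv k : random_vector (eta k).
Proof. exact: (@adapted_random_vector _ k eta (state_adapted 0)). Qed.

Let v_rv k : random_vector (v k).
Proof. exact: (@adapted_random_vector _ k v v_adapted). Qed.

Let z_rv k : random_vector (z k).
Proof. exact: mt_rv. Qed.

Lemma dissipation_step k :
  \int[P]_t (V k.+1 (eta k.+1 t))%:E + \int[P]_t (enorm (z k t) ^+ 2)%:E <=
  \int[P]_t (V k (eta k t))%:E +
  (gamma ^+ 2)%:E * \int[P]_t (enorm (v k t) ^+ 2)%:E.
Proof.
(* State and disturbance are stacked into one vector, measurable for [natural_filtration w k], hence
   independent of [w k]. *)
pose X t := col_mx (eta k t) (v k t).
have X_rv : random_vector X by exact: random_vector_col_mx.
pose mX : {mfun T >-> borel_cV R (p + nv)} :=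
  HB.pack X (isMeasurableFun.Build _ _ _ _ _ X_rv).
pose mW : {mfun T >-> borel_cV R nw} :=
  HB.pack (w k) (isMeasurableFun.Build _ _ _ _ _ (w_rv k)).
pose h (x : borel_cV R (p + nv) * borel_cV R nw) : \bar R :=
  (V k.+1 (ft k (usubmx x.1) x.2 (dsubmx x.1)))%:E.
have h0 x : 0 <= h x by rewrite lee_fin.
have fst_rv :
    @random_vector R _ (borel_cV R (p + nv) * borel_cV R nw)%type _ fst.
  exact: measurable_fst.
have snd_rv :
    @random_vector R _ (borel_cV R (p + nv) * borel_cV R nw)%type _ snd.
  exact: measurable_snd.
have mh : measurable_fun setT h.
  apply/measurable_EFinP.
  apply: (continuous_random_variable (@V_continuous k.+1)).
  apply: ft_rv => //; first exact: random_vector_usubmx.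
  exact: random_vector_dsubmx.
have hE s t : h (X t, w k s) = (V k.+1 (ft k (eta k t) (w k s) (v k t)))%:E.
  by rewrite /h /= col_mxKu col_mxKd.
have X_filtration (B : set (borel_cV R (p + nv))) : measurable B ->
    natural_filtration w k (X @^-1` B).
  move: B; apply: (proj1 (random_vector_filtration k X)).
  by apply: random_vector_col_mx; apply/random_vector_filtration;
    [exact: (state_adapted 0 (k := k))|exact: (v_adapted (k := k))].
have freeze : \int[P]_t (V k.+1 (eta k.+1 t))%:E =
    \int[P]_t \int[P]_s h (X t, w k s).
  transitivity (\int[P]_t h (X t, w k t)); first by apply: eq_integral => t _.
  apply: (integral_indep (X := mX) (W := mW) mh h0) => A B mA mB.
  by apply: natural_filtration_indep => //; exact: X_filtration.
have mI : measurable_fun setT (fun t => \int[P]_s h (X t, w k s)).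
  exact: (measurable_partial_integral P mX mW mh h0).
have mE n (Y : T -> 'cV[R]_n) : random_vector Y ->
    measurable_fun setT (fun t => (enorm (Y t) ^+ 2)%:E).
  by move=> Y_rv; apply/measurable_EFinP; exact: measurable_enorm_sqr.
have mV : measurable_fun setT (fun t => (V k (eta k t))%:E).
  apply/measurable_EFinP.
  exact: (continuous_random_variable (@V_continuous k)).
have mg : measurable_fun setT
    (fun t => (gamma ^+ 2)%:E * (enorm (v k t) ^+ 2)%:E).
  by apply: measurable_funeM; exact: mE.
have mz := mE _ _ (z_rv k).
have E0 n (x : 'cV[R]_n) : 0 <= (enorm x ^+ 2)%:E by rewrite lee_fin sqr_ge0.
have g0 t : 0 <= (gamma ^+ 2)%:E * (enorm (v k t) ^+ 2)%:E.
  by rewrite mule_ge0 // lee_fin sqr_ge0.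
have VE0 t : 0 <= (V k (eta k t))%:E by rewrite lee_fin.
have I0 t : 0 <= \int[P]_s h (X t, w k s) by exact: integral_ge0.
rewrite freeze -ge0_integralZl ?lee_fin ?sqr_ge0 //; last exact: mE.
(* All integrands are nonnegative, so additivity holds without integrability and a pointwise
   inequality suffices. *)
rewrite -!ge0_integralD //.
apply: ge0_le_integral => //.
- by move=> t _; rewrite adde_ge0.
- exact: emeasurable_funD.
- exact: emeasurable_funD.
move=> t _; have := V_dissipative k (eta k t) (v k t).
rewrite unlock; under eq_integral do rewrite -hE.
rewrite leeBlDr // add0e -addeA [- _ + _]addeC addeA leeBlDr // EFinM.
by rewrite [X in _ <= X]addeC.
Qed.

(** Keeping the terminal term in [V N] on the left is what lets the induction absorb the next
    [dissipation_step]. *)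
Lemma dissipation_sum N :
  \int[P]_t (V N (eta N t))%:E +
  \sum_(0 <= k < N) \int[P]_t (enorm (z k t) ^+ 2)%:E <=
  (gamma ^+ 2)%:E * \sum_(0 <= k < N) \int[P]_t (enorm (v k t) ^+ 2)%:E.
Proof.
elim: N => [|N IH].
  rewrite !big_nil mule0 adde0.
  by rewrite integral0_eq // => t _; rewrite /eta /= V0.
rewrite !big_nat_recr //= ge0_muleDr.
- rewrite addeCA; apply: (le_trans (leeD2l _ (dissipation_step N))).
  by rewrite addeCA addeA; apply: leeD2r.
- apply: sume_ge0 => k _; apply: integral_ge0 => t _.
  by rewrite lee_fin sqr_ge0.
- by apply: integral_ge0 => t _; rewrite lee_fin sqr_ge0.
Qed.

Lemma energy_series n (u : nat -> T -> 'cV[R]_n) :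
  (forall k, random_vector (u k)) ->
  energy P u = \sum_(0 <= k <oo) \int[P]_t (enorm (u k t) ^+ 2)%:E.
Proof.
move=> u_rv; rewrite /energy integral_nneseries // => k.
  by apply/measurable_EFinP; exact: measurable_enorm_sqr.
by move=> t _; rewrite lee_fin sqr_ge0.
Qed.

Lemma dissipative_energy_le :
  energy P z <= (gamma ^+ 2)%:E * energy P v.
Proof.
have I0 n (Y : T -> 'cV[R]_n) : 0 <= \int[P]_t (enorm (Y t) ^+ 2)%:E.
  by apply: integral_ge0 => t _; rewrite lee_fin sqr_ge0.
(* It suffices to bound each partial sum of the output series. The nonnegative term in [V N] is
   inserted to reach [dissipation_sum], and the partial sums for [v] lie below their limit. *)
rewrite !energy_series //; apply: lime_le.
  by apply: is_cvg_nneseries => k _ _; exact: I0.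
apply: nearW => N.
apply: (@le_trans _ _ (\int[P]_t (V N (eta N t))%:E +
    \sum_(0 <= k < N) \int[P]_t (enorm (z k t) ^+ 2)%:E)).
  by rewrite leeDr //; apply: integral_ge0 => t _; rewrite lee_fin.
apply: (le_trans (dissipation_sum N)); apply: lee_wpmul2l.
  by rewrite lee_fin sqr_ge0.
by apply: nneseries_lim_ge => k _ _; exact: I0.
Qed.

End dissipative_system.

(** * Measurability of the augmented system, and conclusion *)

Lemma random_vector_aug_f (R : realType) (n ny nw nv nh : nat)
    (f : nat -> 'cV[R]_n -> 'cV[R]_nw -> 'cV[R]_nv -> 'cV[R]_n)
    (g : nat -> 'cV[R]_n -> 'cV[R]_nv -> 'cV[R]_ny)
    (fh : nat -> 'cV[R]_nh -> 'cV[R]_nh) (gh : nat -> 'cV[R]_ny -> 'cV[R]_nh)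
    (f_cont : forall k, continuous
       (fun a : 'cV[R]_n * 'cV[R]_nw * 'cV[R]_nv => f k a.1.1 a.1.2 a.2))
    (g_cont : forall k, continuous
       (fun a : 'cV[R]_n * 'cV[R]_nv => g k a.1 a.2))
    (fh_meas : forall k, borel_map (fh k))
    (gh_meas : forall k, borel_map (gh k))
    (d : measure_display) (T : measurableType d) (k : nat)
    (X : T -> 'cV[R]_(n + nh)) (W : T -> 'cV[R]_nw) (Y : T -> 'cV[R]_nv) :
  random_vector X -> random_vector W -> random_vector Y ->
  random_vector (fun t => aug_f f g fh gh k (X t) (W t) (Y t)).
Proof.
move=> mX mW mY.
have mXu := random_vector_usubmx mX; have mXd := random_vector_dsubmx mX.
apply: random_vector_col_mx.
  exact: (continuous_comp_random_vector3 (@f_cont k) mXu mW mY).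
(* The filter maps are only Borel, so [aug_f] need not be continuous: the lower block is measurable
   by composition, continuity being used for [g] alone. *)
apply: random_vectorD; first exact: (borel_map_comp (fh_meas k) mXd).
apply: (borel_map_comp (gh_meas k)).
exact: (continuous_comp_random_vector2 (@g_cont k) mXu mY).
Qed.

Lemma random_vector_aug_m (R : realType) (n nz nv nh : nat)
    (m : nat -> 'cV[R]_n -> 'cV[R]_nv -> 'cV[R]_nz)
    (mh : nat -> 'cV[R]_nh -> 'cV[R]_nz)
    (m_cont : forall k, continuous
       (fun a : 'cV[R]_n * 'cV[R]_nv => m k a.1 a.2))
    (mh_meas : forall k, borel_map (mh k))
    (d : measure_display) (T : measurableType d) (k : nat)
    (X : T -> 'cV[R]_(n + nh)) (Y : T -> 'cV[R]_nv) :
  random_vector X -> random_vector Y ->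
  random_vector (fun t => aug_m m mh k (X t) (Y t)).
Proof.
move=> mX mY; apply: random_vectorB.
  have mXu := random_vector_usubmx mX.
  exact: (continuous_comp_random_vector2 (@m_cont k) mXu mY).
exact: (borel_map_comp (mh_meas k) (random_vector_dsubmx mX)).
Qed.

Theorem lemma2 (R : realType) (d : measure_display) (T : measurableType d)
    (P : probability T R) (n ny nz nw nv nh : nat)
    (w : nat -> T -> 'cV[R]_nw)
    (f : nat -> 'cV[R]_n -> 'cV[R]_nw -> 'cV[R]_nv -> 'cV[R]_n)
    (g : nat -> 'cV[R]_n -> 'cV[R]_nv -> 'cV[R]_ny)
    (m : nat -> 'cV[R]_n -> 'cV[R]_nv -> 'cV[R]_nz)
    (fh : nat -> 'cV[R]_nh -> 'cV[R]_nh)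
    (gh : nat -> 'cV[R]_ny -> 'cV[R]_nh)
    (mh : nat -> 'cV[R]_nh -> 'cV[R]_nz)
    (gamma : R)
    (P_complete : measure_is_complete P)
    (w_rv : forall k, random_vector (w k))
    (w_indep : independent_vectors P w)
    (f_cont : forall k, continuous
       (fun a : 'cV[R]_n * 'cV[R]_nw * 'cV[R]_nv => f k a.1.1 a.1.2 a.2))
    (g_cont : forall k, continuous
       (fun a : 'cV[R]_n * 'cV[R]_nv => g k a.1 a.2))
    (m_cont : forall k, continuous
       (fun a : 'cV[R]_n * 'cV[R]_nv => m k a.1 a.2))
    (f0 : forall k, f k 0 0 0 = 0)
    (g0 : forall k, g k 0 0 = 0)
    (m0 : forall k, m k 0 0 = 0)
    (fh_meas : forall k, borel_map (fh k))
    (gh_meas : forall k, borel_map (gh k))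
    (mh_meas : forall k, borel_map (mh k))
    (fh0 : forall k, fh k 0 = 0)
    (gh0 : forall k, gh k 0 = 0)
    (mh0 : forall k, mh k 0 = 0)
    (gamma_gt0 : 0 < gamma) :
  (exists V : nat -> 'cV[R]_(n + nh) -> R,
     lyapunov_sequence V /\
     dissipative (aug_f f g fh gh) (aug_m m mh) P w gamma V) ->
  externally_stable (aug_f f g fh gh) (aug_m m mh) P w gamma.
Proof.
move=> [V [[V_ge0 V_cont V0 _] V_diss]] v [v_adapted _] _.
apply: (dissipative_energy_le _ _ w_rv w_indep v_adapted
  V_ge0 V_cont V0 V_diss).
  exact: random_vector_aug_f.
exact: random_vector_aug_m.
Qed.
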